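(* Assume the standing setting described in the context, with $\nu>0$ (i.e. $g$ is $\nu$-strongly convex). Let $c_{\alpha} > L_{yx} \geq 0$, $\theta_0=1$ and $\tau_0,\sigma_0 > 0$ be such that $$\left( c_{\alpha} L_{yx} \tau_0 + 2 L_{yy} \right) \sigma_0 < 1 \quad\text{and}\quad 0<\sigma_0\le \frac{9+3\sqrt{13}}{2\nu}.$$ Let $(x^{\ast},y^{\ast})\in\mathcal{H}\times\mathcal{G}$ be a saddle point of $\min_{x\in\mathcal{H}}\max_{y\in\mathcal{G}}\Psi(x,y)$. Let $(x_k,y_k)_{k\ge0}$ be the sequence generated by the algorithm OGAProx with the adaptive parameters $$\theta_{k+1} = \frac{1}{\sqrt{1 + \nu \sigma_{k}}} < 1,\qquad \tau_{k+1} = \frac{\tau_{k}}{\theta_{k+1}} > \tau_{k},\qquad \sigma_{k+1} = \theta_{k+1} \sigma_{k} < \sigma_{k}\qquad\text{for all } k\ge 0.$$ Then for all $K\ge 1$ $$\|y^{\ast}-y_{K}\| \leq \frac{c_{1}}{K} \left( \frac{1}{2 \tau_{0}} \|x^{\ast}-x_{0}\|^{2} + \frac{1}{2 \sigma_{0}} \|y^{\ast}-y_{0}\|^{2} \right)^{\frac{1}{2}},$$ with $c_{1} := \sqrt{\frac{18}{\nu^{2} \sigma_{0} \delta}}$, where $$\delta := \min\left\{ 1 - \frac{L_{yx}}{c_{\alpha}},\ 1 - \left( c_{\alpha} L_{yx} \tau_{0} + 2 L_{yy} \right) \sigma_{0}\right\} > 0.$$ Furthermore, for $K\ge1$ denote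 $$T_{K} = \sum_{k=0}^{K-1} t_{k},\qquad \bar{x}_{K} = \frac{1}{T_{K}} \sum_{k=0}^{K-1} t_{k} x_{k+1},\qquad \bar{y}_{K} = \frac{1}{T_{K}} \sum_{k=0}^{K-1} t_{k} y_{k+1},$$ where $t_k=\frac{\tau_k}{\tau_0}$ for all $k\ge0$. Then for all $K\ge2$ $$0 \leq \Psi(\bar{x}_{K},y^{\ast}) - \Psi(x^{\ast},\bar{y}_{K}) \leq \frac{c_{2}}{K^{2}} \left( \frac{1}{2 \tau_{0}} \|x^{\ast}-x_{0}\|^{2} + \frac{1}{2 \sigma_{0}} \|y^{\ast}-y_{0}\|^{2} \right),$$ with $c_{2} := \frac{12}{\nu \sigma_{0}}$.
   Context: Setting. $\mathcal{H},\mathcal{G}$ are real Hilbert spaces, $\Phi:\mathcal{H}\times\mathcal{G}\to\mathbb{R}\cup\{+\infty\}$ with $\operatorname{dom}\Phi := \{(x,y) : \Phi(x,y)<+\infty\}\neq\emptyset$, and $g:\mathcal{G}\to\mathbb{R}\cup\{+\infty\}$ with $\operatorname{dom} g := \{y : g(y)<+\infty\}$. Put $P := \Pr_{\mathcal{H}}(\operatorname{dom}\Phi) := \{u\in\mathcal{H} : \exists y\in\mathcal{G},\ (u,y)\in\operatorname{dom}\Phi\}$. Standing assumptions: (i) $g$ is proper, lower semicontinuous and convex with modulus $\nu\ge 0$, i.e. $g-\frac{\nu}{2}\|\cdot\|^2$ is convex; (ii) for all $y\in\operatorname{dom} g$, $\Phi(\cdot,y):\mathcal{H}\to\mathbb{R}\cup\{+\infty\}$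 is proper, convex and lower semicontinuous; (iii) for all $x\in P$, $\operatorname{dom}\Phi(x,\cdot)=\mathcal{G}$ and $\Phi(x,\cdot):\mathcal{G}\to\mathbb{R}$ is concave and Fréchet differentiable, with gradient at $y$ denoted $\nabla_y\Phi(x,y)$; moreover $P$ is closed; (iv) $L_{yx},L_{yy}\ge 0$ are constants such that for all $(x,y),(x',y')\in P\times\operatorname{dom} g$: $\|\nabla_y\Phi(x,y)-\nabla_y\Phi(x',y')\|\le L_{yx}\|x-x'\|+L_{yy}\|y-y'\|$. The objective is $\Psi(x,y) := \Phi(x,y)-g(y)$ with the convention $+\infty-(+\infty):=+\infty$; thus $\Psi(x,y)=-\infty$ if $x\in P$, $y\notin\operatorname{dom} g$; $\Psi(x,y)=\Phi(x,y)-g(y)\in\mathbb{R}$ if $x\in P$, $y\in\operatorname{dom} g$; $\Psi(x,y)=+\infty$ if $x\notin P$. A saddle point is a point $(x^*,y^* )\in\mathcal{H}\times\mathcal{G}$ with $\Psi(x^*,y)\le\Psi(x^*,y^* )\le\Psi(x,y^* )$ for all $(x,y)\in\mathcal{H}\times\mathcal{G}$. It is assumed that a saddle point exists. For a proper, convex, lower semicontinuous $f$ on a real Hilbert space, $\operatorname{prox}_f(x):=\operatorname{argmin}_u\{f(u)+\frac12\|u-x\|^2\}$. Algorithm OGAProx. Given $x_0\in P$, $y_0\in\operatorname{dom} g$, with $x_{-1}:=x_0$, $y_{-1}:=y_0$, and parameters $\sigma_k,\tau_k>0$, $\theta_k\in(0,1]$, for all $k\ge 0$: $y_{k+1}:=\operatorname{prox}_{\sigma_k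 g}\big(y_k+\sigma_k[(1+\theta_k)\nabla_y\Phi(x_k,y_k)-\theta_k\nabla_y\Phi(x_{k-1},y_{k-1})]\big)$, $x_{k+1}:=\operatorname{prox}_{\tau_k\Phi(\cdot,y_{k+1})}(x_k)$. *)

(* Defs.v *)
From HB Require Import structures.
From mathcomp Require Import all_boot all_order all_algebra.
From mathcomp Require Import all_classical all_reals all_analysis.

Set Implicit Arguments.
Unset Strict Implicit.
Unset Printing Implicit Defensive.

Import Order.TTheory GRing.Theory Num.Theory.
Import numFieldNormedType.Exports.

Local Open Scope classical_set_scope.
Local Open Scope ring_scope.

HB.mixin Record hasInner (R : realType) H & CompleteNormedModule R H := {
  inner : {dot H for (@idfun R)};
  inner_norm : forall u : H, inner u u = `|u| ^+ 2
}.

#[short(type="hilbertType")]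
HB.structure Definition Hilbert (R : realType) :=
  {H of CompleteNormedModule R H & hasInner R H}.

(* Functions with values in R `|` {+oo} are \bar R-valued functions that never
   take the value -oo (see [eproper] and the theorem's hypothesis on Phi). *)
Section ExtendedRealFunctions.
Context {R : realType} {E : hilbertType R}.
Implicit Types f : E -> \bar R.
Local Open Scope ereal_scope.

Definition edom f : set E := [set u | f u < +oo].

Definition eproper f := (forall u, f u != -oo) /\ edom f !=set0.

(* For f > -oo no oo - oo occurs on the right, and 0 * +oo = 0 makes the
   endpoints t = 0 and t = 1 trivially true. *)
Definition econvex f := forall (t : R) (u v : E), (0 <= t <= 1)%R ->
  f (t *: u + (1 - t) *: v)%R <= t%:E * f u + (1 - t)%:E * f v.

Definition convex_modulus (nu : R) f :=
  econvex (fun u => f u - (nu / 2 * `|u| ^+ 2)%:E).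

Definition argmin f : set E := [set u | forall v, f u <= f v].

Definition prox f (x : E) : set E :=
  argmin (fun u => f u + (2^-1 * `|u - x| ^+ 2)%:E).

End ExtendedRealFunctions.

Definition concave {R : realType} {E : hilbertType R} (f : E -> R) :=
  convex_function setT (fun u : convex_lmodType E => - f u : R^o).

Definition is_gradient {R : realType} {E : hilbertType R} (f : E -> R)
    (y v : E) :=
  differentiable (f : E -> R^o) y /\
  forall h : E, 'd (f : E -> R^o) y h = inner v h.

Section SaddleProblem.
Context {R : realType} {H G : hilbertType R}.
Variables (Phi : H -> G -> \bar R) (g : G -> \bar R).
Local Open Scope ereal_scope.

Definition proj_dom : set H := [set u | exists y, Phi u y < +oo].

(* The case distinction is the convention +oo - (+oo) := +oo; the library's
   subtraction gives -oo there. *)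
Definition Psi (x : H) (y : G) : \bar R :=
  if Phi x y == +oo then +oo else Phi x y - g y.

Definition saddle_point (xs : H) (ys : G) :=
  forall x y, Psi xs y <= Psi xs ys /\ Psi xs ys <= Psi x ys.

(* [k.-1] is 0 for k = 0, which renders x_{-1} := x_0 and y_{-1} := y_0. *)
Definition OGAProx (grad : H -> G -> G) (sigma tau theta : nat -> R)
    (x : nat -> H) (y : nat -> G) :=
  [/\ proj_dom (x 0%N), edom g (y 0%N) &
   forall k : nat,
     prox (fun v => (sigma k)%:E * g v)
       (y k + sigma k *: ((1 + theta k) *: grad (x k) (y k)
                          - theta k *: grad (x k.-1) (y k.-1)))%R
       (y k.+1) /\
     prox (fun u => (tau k)%:E * Phi u (y k.+1)) (x k) (x k.+1)].

End SaddleProblem.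

(* Weighted averages with weights t_k, normalised by T_K = \sum_(k < K) t_k. *)
Definition weight_sum {R : realType} (t : nat -> R) (K : nat) : R :=
  \sum_(0 <= k < K) t k.

Definition weighted_mean {R : realType} {E : hilbertType R} (t : nat -> R)
    (z : nat -> E) (K : nat) : E :=
  (weight_sum t K)^-1 *: \sum_(0 <= k < K) t k *: z k.+1.

(* Main.v *)
(* The optimality condition of each proximal step, together with concavity of
   Phi in y, bounds the primal-dual gap at (x_{k+1}, y_{k+1}) by differences of
   squared distances plus the inner products <d_k, ys - y_k>, where d_k is the
   increment of the gradients. With the weights t_k = tau_k / tau_0 =
   sigma_0 / sigma_k one has t_{k+1} theta_{k+1} = t_k and
   t_{k+1} / sigma_{k+1} = t_k (1 / sigma_k + nu), so a Lyapunov function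
   telescopes and sum_k t_k gap_k + delta t_K / (2 sigma_K) |ys - y_K|^2 is at
   most the initial value. The rates follow from nu sigma_k <= 3 / k, which also
   gives T_K >= nu sigma_0 K^2 / 12, and from Jensen's inequality. *)
Require Import Defs.
From mathcomp Require Import all_boot all_order all_algebra.
From mathcomp Require Import all_classical all_reals all_analysis.
From mathcomp Require Import ring lra.

Set Implicit Arguments.
Unset Strict Implicit.
Unset Printing Implicit Defensive.

Import Order.TTheory GRing.Theory Num.Theory.
Import numFieldNormedType.Exports.

Local Open Scope classical_set_scope.
Local Open Scope ring_scope.

(** * Inner product identities and the gradient inequality for concave functions *)

Section InnerProduct.
Context {R : realType} {E : hilbertType R}.
Implicit Types u v w : E.

Lemma innerC u v : inner u v = inner v u.
Proof. by rewrite hermC expr0 mul1r. Qed.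

Lemma innerDr u v w : inner u (v + w) = inner u v + inner u w.
Proof. exact: linearDr. Qed.

Lemma innerDl u v w : inner (u + v) w = inner u w + inner v w.
Proof. by rewrite innerC innerDr !(innerC w). Qed.

Lemma innerZr a u v : inner u (a *: v) = a * inner u v.
Proof. by rewrite linearZr_LR. Qed.

Lemma innerZl a u v : inner (a *: u) v = a * inner u v.
Proof. by rewrite innerC innerZr innerC. Qed.

Lemma innerNr u v : inner u (- v) = - inner u v.
Proof. by rewrite -scaleN1r innerZr mulN1r. Qed.

Lemma innerNl u v : inner (- u) v = - inner u v.
Proof. by rewrite innerC innerNr innerC. Qed.

Lemma normD_sqr u v : `|u + v| ^+ 2 = `|u| ^+ 2 + 2 * inner u v + `|v| ^+ 2.
Proof. by rewrite -!inner_norm !innerDl !innerDr (innerC v u); ring. Qed.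

(** The law of cosines, in the form that turns the inner product of a proximal optimality condition
    into differences of squared distances. *)
Lemma inner_polar u v w :
  - inner (u - v) (w - v) =
  2^-1 * (`|w - u| ^+ 2 - `|u - v| ^+ 2 - `|w - v| ^+ 2).
Proof.
rewrite -!inner_norm !(innerDl, innerDr, innerNl, innerNr).
by rewrite (innerC v u) (innerC w u) (innerC w v); field.
Qed.

Lemma inner_CauchySchwarz u v : `|inner u v| <= `|u| * `|v|.
Proof.
have [->|v0] := eqVneq v 0.
  by rewrite -(scale0r (0 : E)) innerZr mul0r !normr0 scale0r normr0 mulr0.
have nv : 0 < `|v| by rewrite normr_gt0.
(* This vector is [|v|^2] times the component of [u] orthogonal to [v]; the factor avoids a
   division. *)
have := sqr_ge0 `| `|v| ^+ 2 *: u - inner u v *: v|.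
rewrite -inner_norm !(innerDl, innerDr, innerNl, innerNr, innerZl, innerZr).
rewrite (innerC v u) !inner_norm => h.
have {}h : 0 <= `|v| ^+ 2 * ((`|u| * `|v|) ^+ 2 - inner u v ^+ 2) by lra.
rewrite pmulr_rge0 ?exprn_gt0 // subr_ge0 -(real_normK (num_real (inner u v))) in h.
by rewrite ler_sqr ?nnegrE ?mulr_ge0 in h.
Qed.

Lemma concave_ge (F : E -> R) (t : R) u v : concave F -> 0 <= t <= 1 ->
  t * F u + (1 - t) * F v <= F (t *: u + (1 - t) *: v).
Proof.
move=> cF /andP[t0 t1].
have := cF (Itv01 t0 t1) u v; rewrite !inE => /(_ I I).
by rewrite convRE /conv /= /unstable.onem => h; lra.
Qed.

(** By concavity the difference quotients along [u - y] are at least [F u - F y] for [0 < t <= 1];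
    their limit from the right is the derivative. *)
Lemma concave_gradient (F : E -> R) y v u :
  concave F -> is_gradient F y v -> F u <= F y + inner v (u - y).
Proof.
move=> cF [dF gF]; rewrite -gF -deriveE // addrC -lerBlDr.
have dv := @diff_derivable _ _ _ _ _ (u - y) dF.
have h := cvg_dnbhs_at_right dv.
rewrite /derive -(cvg_lim _ h) //; apply: limr_ge; first by apply/cvg_ex; eexists; exact: h.
near=> t.
have t0 : 0 < t by near: t; exact: nbhs_right_gt.
have t1 : t <= 1 by near: t; exact: nbhs_right_le.
rewrite /= /GRing.scale /= mulrC ler_pdivlMr //.
have -> : t *: (u - y) + y = t *: u + (1 - t) *: y.
  by rewrite scalerBr scalerBl scale1r -addrA (addrC (- _)).
have := @concave_ge F t u y cF; rewrite t1 ltW // => /(_ isT); lra.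
Unshelve. all: by end_near.
Qed.
End InnerProduct.

(** An elementary substitute for letting [t] tend to 0: if [A > 0], then [t = 1] gives [B > 0], and
    [t = min(1, A / (2 B))] gives [A <= A / 2]. *)
Lemma le0_scaled (R : realFieldType) (A B : R) :
  (forall t, 0 < t <= 1 -> A <= t * B) -> A <= 0.
Proof.
move=> key; rewrite leNgt; apply/negP => A0.
have B0 : 0 < B by have := key 1; rewrite ltr01 lexx => /(_ isT); lra.
have AB : 0 < A / (2 * B) by rewrite divr_gt0 // mulr_gt0.
have := key (Num.min 1 (A / (2 * B))).
rewrite lt_min ltr01 AB ge_min lexx => /(_ isT).
apply/negP; rewrite -ltNge.
apply: (@le_lt_trans _ _ (A / (2 * B) * B)).
  by rewrite ler_wpM2r ?(ltW B0) // ge_min lexx orbT.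
have -> : A / (2 * B) * B = A / 2 by field; rewrite gt_eqF.
by lra.
Qed.

(** * Convex extended-real functions, proximal points and Jensen's inequality *)

Section ConvexFunctions.
Context {R : realType} {E : hilbertType R}.
Implicit Types (f : E -> \bar R) (u v p z : E).

Lemma econvex_fin f t u v a b : econvex f -> 0 <= t <= 1 ->
  (f u <= a%:E)%E -> (f v <= b%:E)%E ->
  (f (t *: u + (1 - t) *: v)%R <= (t * a + (1 - t) * b)%:E)%E.
Proof.
move=> cf t01 fu fv; apply: le_trans (cf _ _ _ t01) _.
have /andP[t0 t1] := t01.
by rewrite [leRHS]EFinD !EFinM leeD // lee_wpmul2l // lee_fin // subr_ge0.
Qed.

Lemma normD_convex t u v : `|t *: u + (1 - t) *: v| ^+ 2 =
  t * `|u| ^+ 2 + (1 - t) * `|v| ^+ 2 - t * (1 - t) * `|u - v| ^+ 2.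
Proof.
rewrite -!inner_norm !(innerDl, innerDr, innerNl, innerNr, innerZl, innerZr).
by rewrite (innerC v u); ring.
Qed.

Lemma convex_modulus_fin nu f t u v a b : convex_modulus nu f -> 0 <= t <= 1 ->
  (f u <= a%:E)%E -> (f v <= b%:E)%E ->
  (f (t *: u + (1 - t) *: v)%R <=
   (t * a + (1 - t) * b - nu / 2 * (t * (1 - t) * `|u - v| ^+ 2))%:E)%E.
Proof.
move=> cf t01 fu fv.
have /(_ u v (a - nu / 2 * `|u| ^+ 2) (b - nu / 2 * `|v| ^+ 2)) :=
  econvex_fin cf t01.
rewrite !EFinB !leeD2rE // => /(_ fu fv).
rewrite leeBlDr // -EFinB -EFinD normD_convex.
by congr (_ <= _%:E)%E; field.
Qed.

Lemma econvex_modulus0 f : econvex f -> convex_modulus 0 f.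
Proof.
by rewrite /convex_modulus; under eq_fun do rewrite mul0r mul0r sube0.
Qed.

(** For finite values the quadratic term of [convex_modulus_fin] is dropped. An infinite value with
    positive weight makes the right side [+oo]; the endpoints are separate because there the weight
    is 0. *)
Lemma convex_modulusW nu f : 0 <= nu -> convex_modulus nu f ->
  (forall u, f u != -oo%E) -> econvex f.
Proof.
move=> nu0 cf fN t u v t01; have /andP[t0 t1] := t01.
have [->|tn0] := eqVneq t 0.
  by rewrite scale0r add0r subr0 scale1r mul0e add0e mul1e.
have [->|tn1] := eqVneq t 1.
  by rewrite subrr scale0r scale1r addr0 mul0e adde0 mul1e.
have t_gt0 : 0 < t by rewrite lt_def tn0.
have t_lt1 : 0 < 1 - t by rewrite subr_gt0 lt_def eq_sym tn1.
case fu : (f u) => [a| |]; last by have := fN u; rewrite fu.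
- case fv : (f v) => [b| |]; last by have := fN v; rewrite fv.
    apply: le_trans (@convex_modulus_fin nu f t u v a b cf t01 _ _) _;
      rewrite ?fu ?fv //.
    rewrite -!EFinM -EFinD lee_fin gerBl.
    by rewrite !mulr_ge0 ?invr_ge0 ?sqr_ge0 // ltW.
  by rewrite gt0_muley ?lte_fin // addey // leey.
- rewrite gt0_muley ?lte_fin // addye ?leey //.
  case fv : (f v) => [b| |]; last by have := fN v; rewrite fv.
    by [].
  by rewrite gt0_muley ?lte_fin.
Qed.

Lemma prox_fin f c z p u : (forall v, f v != -oo%E) -> 0 < c ->
  prox (fun v => (c%:E * f v)%E) z p -> edom f u -> f p \is a fin_num.
Proof.
move=> fN c0 /(_ u); rewrite /edom /=.
case: (f u) (fN u) => // a _ + _.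
case fp : (f p) => [b| |] //; last by have := fN p; rewrite fp.
by rewrite gt0_muley ?lte_fin // addye // -EFinM -EFinD leNgt ltry.
Qed.

(* Comparing p with t u + (1 - t) p and letting t -> 0. *)
Lemma prox_ineq nu f c z p u a : convex_modulus nu f ->
  (forall v, f v != -oo%E) -> 0 < c ->
  prox (fun v => (c%:E * f v)%E) z p -> f u = a%:E ->
  fine (f p) + c^-1 * inner (z - p) (u - p) + nu / 2 * `|u - p| ^+ 2 <= a.
Proof.
move=> cf fN c0 pp fu.
have fu_ltoo : edom f u by rewrite /edom /= fu ltry.
have fp := fineK (prox_fin fN c0 pp fu_ltoo); move: (fine (f p)) fp => b fp.
(* The left side is [c] times the difference to be bounded. The right side collects the quadratic
   terms in [t], from the squared distance and from the modulus, after division by [t]. *)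
suff key t : 0 < t <= 1 ->
    c * b + inner (z - p) (u - p) + c * (nu / 2) * `|u - p| ^+ 2 - c * a
    <= t * (`|u - p| ^+ 2 / 2 * (1 + c * nu)).
  rewrite -subr_le0 -(pmulr_rle0 _ c0).
  have -> : c * (b + c^-1 * inner (z - p) (u - p) + nu / 2 * `|u - p| ^+ 2 - a)
    = c * b + inner (z - p) (u - p) + c * (nu / 2) * `|u - p| ^+ 2 - c * a.
    by field; rewrite gt_eqF.
  exact: le0_scaled key.
move=> /andP[t0 t1].
have t01 : 0 <= t <= 1 by rewrite ltW.
have := pp (t *: u + (1 - t) *: p); rewrite -fp.
have /(_ u p a b) := convex_modulus_fin cf t01; rewrite fu -fp !lexx.
move=> /(_ isT isT).
set w := t *: u + _ => fw.
have wz : w - z = t *: (u - p) + (p - z).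
  by rewrite /w scalerBr scalerBl scale1r (addrC p) !addrA.
have {}fw : (c%:E * f w <= (c * (t * a + (1 - t) * b -
     nu / 2 * (t * (1 - t) * `|u - p| ^+ 2)))%:E)%E.
  by rewrite EFinM lee_wpmul2l // lee_fin ltW.
move=> /le_trans /(_ (leeD2r _ fw)).
rewrite -EFinM -!EFinD lee_fin wz (normD_sqr (t *: _)) innerZl normrZ exprMn.
rewrite real_normK ?num_real // innerC.
have -> : inner (p - z) (u - p) = - inner (z - p) (u - p).
  by rewrite -innerNl opprB.
move=> h; rewrite -(ler_pM2l t0); lra.
Qed.

Lemma weight_sumS (t : nat -> R) K :
  weight_sum t K.+1 = weight_sum t K + t K.
Proof. by rewrite /weight_sum big_nat_recr. Qed.

Lemma weight_sum_gt0 (t : nat -> R) K : (forall k, 0 < t k) -> (0 < K)%N ->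
  0 < weight_sum t K.
Proof.
move=> t0; case: K => // K _; elim: K => [|K IH].
  by rewrite /weight_sum big_nat1.
by rewrite weight_sumS addr_gt0.
Qed.

(** Jensen's inequality by induction: the mean of [K.+2] points is the convex combination, with
    coefficient [l], of the mean of the first [K.+1] and the last point. *)
Lemma econvex_mean f (t : nat -> R) (z : nat -> E) (a : nat -> R) K :
  econvex f -> (forall k, 0 < t k) -> (0 < K)%N ->
  (forall k, (f (z k.+1) <= (a k)%:E)%E) ->
  (f (weighted_mean t z K) <=
   ((weight_sum t K)^-1 * \sum_(0 <= k < K) t k * a k)%:E)%E.
Proof.
move=> cf t0 + fa; case: K => // K _; elim: K => [|K IH].
  rewrite /weighted_mean /weight_sum !big_nat1 scalerA mulrA.
  by rewrite mulVf ?gt_eqF // scale1r mul1r.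
have TK := @weight_sum_gt0 t K.+1 t0 isT.
have TK1 := @weight_sum_gt0 t K.+2 t0 isT.
set l := weight_sum t K.+1 / weight_sum t K.+2.
have l1 : 1 - l = t K.+1 / weight_sum t K.+2.
  rewrite /l -[1](divff (x := weight_sum t K.+2)) ?gt_eqF // -mulrBl.
  by rewrite (weight_sumS _ K.+1) addrC addKr.
have l01 : 0 <= l <= 1.
  rewrite /l divr_ge0 ?(ltW TK) ?(ltW TK1) //= ler_pdivrMr // mul1r.
  by rewrite (weight_sumS _ K.+1) lerDl ltW.
have -> : weighted_mean t z K.+2 =
    l *: weighted_mean t z K.+1 + (1 - l) *: z K.+2.
  rewrite l1 /weighted_mean big_nat_recr //= scalerDr !scalerA.
  by rewrite /l mulrAC divff ?gt_eqF // mul1r (mulrC (t _)).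
apply: le_trans (econvex_fin cf l01 IH (fa _)) _.
rewrite lee_fin l1 /l [X in _ <= _ * X]big_nat_recr //=.
rewrite le_eqVlt; apply/orP; left; apply/eqP; field.
by rewrite !gt_eqF.
Qed.

End ConvexFunctions.

(** * Step sizes, their invariants and the growth of the weights *)

Section StepSizes.
Context (R : realType) (nu : R) (tau sigma theta : nat -> R).
Context (nu_gt0 : 0 < nu) (theta0 : theta 0%N = 1).
Context (tau0_gt0 : 0 < tau 0%N) (sigma0_gt0 : 0 < sigma 0%N).
Context (thetaS : forall k, theta k.+1 = 1 / Num.sqrt (1 + nu * sigma k)).
Context (tauS : forall k, tau k.+1 = tau k / theta k.+1).
Context (sigmaS : forall k, sigma k.+1 = theta k.+1 * sigma k).

Let t k := tau k / tau 0%N.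

Lemma sigma_theta_gt0 k : 0 < sigma k /\ 0 < theta k.+1.
Proof.
have h n : 0 < sigma n -> 0 < theta n.+1.
  by move=> s; rewrite thetaS divr_gt0 // sqrtr_gt0 addr_gt0 // mulr_gt0.
suff s : 0 < sigma k by split; [|exact: h].
by elim: k => // k IH; rewrite sigmaS mulr_gt0 // h.
Qed.

Lemma sigma_gt0 k : 0 < sigma k. Proof. by have [] := sigma_theta_gt0 k. Qed.

Lemma thetaS_gt0 k : 0 < theta k.+1.
Proof. by have [] := sigma_theta_gt0 k. Qed.

Lemma thetaS_sqr k : theta k.+1 ^+ 2 * (1 + nu * sigma k) = 1.
Proof.
have h : 0 < 1 + nu * sigma k by rewrite addr_gt0 // mulr_gt0 // sigma_gt0.
rewrite thetaS expr_div_n expr1n sqr_sqrtr ?ltW //.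
by rewrite mul1r mulVf // gt_eqF.
Qed.

Lemma thetaS_lt1 k : theta k.+1 < 1.
Proof.
have s := mulr_gt0 nu_gt0 (sigma_gt0 k).
rewrite -(@expr_lt1 _ 2) ?(ltW (thetaS_gt0 k)) // -(thetaS_sqr k).
by rewrite ltr_pMr ?exprn_gt0 ?thetaS_gt0 // ltrDl.
Qed.

Lemma tau_gt0 k : 0 < tau k.
Proof. by elim: k => // k IH; rewrite tauS divr_gt0 // thetaS_gt0. Qed.

Lemma tauS_gt k : tau k < tau k.+1.
Proof.
by rewrite tauS ltr_pdivlMr ?thetaS_gt0 // gtr_pMr ?tau_gt0 // thetaS_lt1.
Qed.

Lemma sigmaS_lt k : sigma k.+1 < sigma k.
Proof. by rewrite sigmaS gtr_pMl ?sigma_gt0 // thetaS_lt1. Qed.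

Lemma tau_pred_le k : tau k.-1 <= tau k.
Proof. by case: k => // k; rewrite ltW // tauS_gt. Qed.

Lemma sigma_le0 k : sigma k <= sigma 0%N.
Proof. by elim: k => // k; apply: le_trans; rewrite ltW // sigmaS_lt. Qed.

(** The factors [theta] cancel. This invariant carries the condition on the initial step sizes over
    to every iteration. *)
Lemma tau_sigma k : tau k * sigma k = tau 0%N * sigma 0%N.
Proof.
elim: k => // k IH; rewrite tauS sigmaS -IH; field.
by rewrite gt_eqF // thetaS_gt0.
Qed.

Lemma weight_gt0 k : 0 < t k.
Proof. by rewrite divr_gt0 // tau_gt0. Qed.

Lemma weightE k : t k = sigma 0%N / sigma k.
Proof.
have s := sigma_gt0 k.
rewrite -[LHS](mulfK (x := sigma k)) ?gt_eqF // /t (mulrAC (tau k)) tau_sigma.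
by rewrite (mulrC (tau 0%N)) mulfK // gt_eqF.
Qed.

(** Gives the extrapolation term of step [k] the weight that its counterpart received in the step
    before. At [k = 0] both sides are [t 0], by [theta0]. *)
Lemma weight_theta k : t k * theta k = t k.-1.
Proof.
case: k => [|k]; first by rewrite theta0 mulr1.
rewrite /t tauS; field.
by rewrite !gt_eqF // thetaS_gt0.
Qed.

(** The purpose of the choice of [theta]: since [theta k.+1 ^- 2 = 1 + nu * sigma k], the gain [nu]
    from strong convexity is exactly the growth of the dual weight. *)
Lemma weight_sigmaS k : t k.+1 / sigma k.+1 = t k * ((sigma k)^-1 + nu).
Proof.
rewrite !weightE sigmaS.
have s := sigma_gt0 k; have th := thetaS_gt0 k.
have -> : sigma 0%N / (theta k.+1 * sigma k) / (theta k.+1 * sigma k) =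
  sigma 0%N / sigma k ^+ 2 * (theta k.+1 ^+ 2)^-1 by field; rewrite !gt_eqF.
have -> : (theta k.+1 ^+ 2)^-1 = 1 + nu * sigma k.
  rewrite -[RHS]mul1r -[X in X * _](mulVf (x := theta k.+1 ^+ 2)).
    by rewrite -mulrA thetaS_sqr mulr1.
  by rewrite gt_eqF // exprn_gt0.
by field; rewrite gt_eqF.
Qed.

(* The bound on [sigma 0] is what makes the case k = 0 hold:
   s / sqrt (1 + s) <= 3 iff s is at most the positive root of s^2 = 9 (1 + s). *)
Lemma sigmaS_le k : sigma 0%N <= (9 + 3 * Num.sqrt 13) / (2 * nu) ->
  nu * sigma k.+1 <= 3 / k.+1%:R.
Proof.
move=> s0le.
(* The recursion without the square root; both cases below square the claim and multiply it by
   [1 + nu * sigma n] in order to use it. *)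
have sq n : (nu * sigma n.+1) ^+ 2 * (1 + nu * sigma n) = (nu * sigma n) ^+ 2.
  rewrite sigmaS; have := thetaS_sqr n => h.
  by rewrite mulrCA exprMn mulrAC h mul1r.
have s n := mulr_gt0 nu_gt0 (sigma_gt0 n).
elim: k => [|k IH].
  rewrite divr1 -ler_sqr ?nnegrE ?(ltW (s _)) ?ler0n //.
  rewrite -(ler_pM2r (x := 1 + nu * sigma 0%N)) ?addr_gt0 // sq.
  have r13 : Num.sqrt 13 ^+ 2 = 13 :> R by rewrite sqr_sqrtr.
  have r0 : 0 <= Num.sqrt 13 :> R by rewrite sqrtr_ge0.
  have : nu * sigma 0%N <= (9 + 3 * Num.sqrt 13) / 2.
    rewrite mulrC -ler_pdivlMr //; apply: le_trans s0le _.
    by rewrite invfM mulrA.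
  have := s 0%N; set a := nu * sigma 0%N; set r := Num.sqrt 13 in r13 r0 *.
  (* [a^2 - 9 a - 9] is factored over its two roots; [3 <= r] makes the smaller root nonpositive, so
     the second factor is nonnegative. *)
  move=> a0 ale; have r3 : 3 <= r by nra.
  have : (a - (9 + 3 * r) / 2) * (a - (9 - 3 * r) / 2) <= 0.
    by apply: mulr_le0_ge0; lra.
  by lra.
have k0 : 0 < k.+1%:R :> R by rewrite ltr0n.
have k2 : k.+2%:R = k.+1%:R + 1 :> R by rewrite -natr1.
have k1 : 1 <= k.+1%:R :> R by rewrite ler1n.
rewrite k2; set n := k.+1%:R in IH k0 k1 *.
have n1 : 0 < n + 1 by lra.
rewrite -ler_sqr ?nnegrE ?(ltW (s _)) ?divr_ge0 ?(ltW n1) //.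
rewrite -(ler_pM2r (x := 1 + nu * sigma k.+1)) ?addr_gt0 // sq.
have := s k.+1; set a := nu * sigma k.+1 in IH * => a0.
have an : a * n <= 3 by rewrite -ler_pdivlMr.
rewrite expr_div_n mulrAC ler_pdivlMr ?exprn_gt0 //.
(* a^2 (n + 1)^2 <= a^2 (n^2 + 3 n) since n >= 1, and a n <= 3. *)
have h1 : a ^+ 2 * (n + 1) ^+ 2 <= a ^+ 2 * (n ^+ 2 + 3 * n).
  by rewrite ler_pM2l ?exprn_gt0 //; nra.
have h2 : (a * n) ^+ 2 <= 9.
  by have := mulr_ge0 (ltW a0) (ltW k0); nra.
have h3 : a * (a * n) <= a * 3 by rewrite ler_pM2l.
by apply: le_trans h1 _; nra.
Qed.

(** By [sigmaS_le] the weights grow linearly, [t k >= k nu sigma_0 / 3], so their sum is at least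
    [K (K - 1) / 2] times the slope; [K - 1 >= K / 2] for [K >= 2] yields the 12. *)
Lemma weight_sum_ge K : sigma 0%N <= (9 + 3 * Num.sqrt 13) / (2 * nu) ->
  (2 <= K)%N -> K%:R ^+ 2 * (nu * sigma 0%N / 12) <= weight_sum t K.
Proof.
move=> s0le K2.
have tk k : k%:R * (nu * sigma 0%N / 3) <= t k.
  case: k => [|k]; first by rewrite mul0r ltW // weight_gt0.
  rewrite weightE ler_pdivlMr ?sigma_gt0 //.
  have k0 : 0 < k.+1%:R :> R by rewrite ltr0n.
  have := sigmaS_le k s0le; rewrite ler_pdivlMr // => h.
  have := ler_wpM2l (ltW sigma0_gt0) h; lra.
have h : K%:R * (K%:R - 1) / 2 * (nu * sigma 0%N / 3) <= weight_sum t K.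
  elim: K {K2} => [|K IH]; first by rewrite /weight_sum big_geq // !mul0r.
  rewrite weight_sumS; apply: le_trans (lerD IH (tk K)).
  by rewrite -natr1; lra.
apply: le_trans h.
have K2R : 2 <= K%:R :> R by rewrite ler_nat.
have c0 : 0 < nu * sigma 0%N by rewrite mulr_gt0.
have KK : 0 <= K%:R * (K%:R - 2) :> R by rewrite mulr_ge0 // subr_ge0.
by have := mulr_ge0 (ltW c0) KK; lra.
Qed.

End StepSizes.

(** * Finiteness at the saddle point and the primal-dual gap *)

Section Saddle.
Context (R : realType) (H G : hilbertType R).
Context (Phi : H -> G -> \bar R) (g : G -> \bar R).
Context (Phi_codom : forall x y, Phi x y != -oo%E).
Context (g_proper : eproper g).
Context (Phi_y_dom : forall x, proj_dom Phi x -> edom (Phi x) = setT).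
Context (xs : H) (ys : G) (xs_ys_saddle : saddle_point Phi g xs ys).

(** The difference of [Psi u ys] and [Psi xs v] in real numbers. As [fine] sends infinite values to
    0, it has this meaning only on the domains. *)
Let gap u v :=
  fine (Phi u ys) - fine (g ys) - (fine (Phi xs v) - fine (g v)).

Lemma proj_dom_fin u v : proj_dom Phi u -> Phi u v \is a fin_num.
Proof.
move=> /Phi_y_dom uT; have : edom (Phi u) v by rewrite uT.
by rewrite /edom /= fin_numE Phi_codom -ltey.
Qed.

Lemma proj_dom_neqy u v : proj_dom Phi u -> (Phi u v == +oo%E) = false.
Proof. by move=> /(proj_dom_fin v); case: (Phi u v). Qed.

Lemma edom_fin v : edom g v -> g v \is a fin_num.
Proof. by rewrite /edom /= fin_numE g_proper.1 -ltey. Qed.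

Lemma Psi_fin u v : proj_dom Phi u -> edom g v ->
  Psi Phi g u v = (fine (Phi u v) - fine (g v))%:E.
Proof.
move=> Pu gv; have Fu := proj_dom_fin v Pu; rewrite /Psi.
by rewrite proj_dom_neqy // EFinB !fineK // edom_fin.
Qed.

(** Otherwise [Psi xs ys = +oo], and the saddle inequality would force [Psi u ys = +oo], although
    [Phi u ys] is finite and [g ys] is not [-oo]. *)
Lemma saddle_proj_dom : (exists u, proj_dom Phi u) -> proj_dom Phi xs.
Proof.
move=> [u Pu]; exists ys; rewrite ltey; apply/eqP => xsy.
have [_] := xs_ys_saddle u ys.
have Fu := proj_dom_fin ys Pu.
rewrite {1}/Psi xsy eqxx leye_eq /Psi proj_dom_neqy // => /eqP.
by move: (g_proper.1 ys) Fu; case: (Phi u ys) => //= r; case: (g ys).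
Qed.

(** If [g ys = +oo], then [Psi xs ys = -oo], which lies below the real number [Psi xs v] for any [v]
    in the domain of [g]. *)
Lemma saddle_edom : (exists u, proj_dom Phi u) -> edom g ys.
Proof.
move=> /saddle_proj_dom Pxs; have [v gv] := g_proper.2.
have [+ _] := xs_ys_saddle xs v; rewrite (Psi_fin Pxs gv) /Psi.
rewrite proj_dom_neqy // /edom /= ltey => h.
apply/eqP => gys; move: h; rewrite gys.
by move: (proj_dom_fin ys Pxs); case: (Phi xs ys).
Qed.

Lemma gap_ge0 u v : proj_dom Phi u -> edom g v -> 0 <= gap u v.
Proof.
move=> Pu gv; have P0 : exists u, proj_dom Phi u by exists u.
have [] := xs_ys_saddle u v.
have Pxs := saddle_proj_dom P0; have gys := saddle_edom P0.
by rewrite !Psi_fin // !lee_fin /gap; lra.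
Qed.

End Saddle.

(** Young's inequality on both products. The weight [c * tau] on [a * e] leaves the fraction
    [Lx / c] of [a^2 / (2 tau)], a square that the primal proximal step supplies. *)
Lemma young (R : realFieldType) (Lx Ly c tau d e a b : R) :
  0 <= Lx -> 0 <= Ly -> 0 < c -> 0 < tau -> 0 <= e -> d <= Lx * a + Ly * b ->
  d * e <= Lx / c * (a ^+ 2 / (2 * tau)) + Ly * (b ^+ 2 / 2)
           + (c * Lx * tau + Ly) * (e ^+ 2 / 2).
Proof.
move=> Lx0 Ly0 c0 tau0 e0 dle.
have h1 := ler_wpM2r e0 dle.
have ct : 0 < c * tau by rewrite mulr_gt0.
have h2 : 0 <= Lx / (2 * (c * tau)) * (a - c * tau * e) ^+ 2.
  by rewrite mulr_ge0 ?sqr_ge0 // divr_ge0 // mulr_ge0 // ltW.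
have e2 : Lx / (2 * (c * tau)) * (a - c * tau * e) ^+ 2 =
  Lx / c * (a ^+ 2 / (2 * tau)) + c * Lx * tau * (e ^+ 2 / 2) - Lx * a * e.
  by field; rewrite !gt_eqF.
have h3 : 0 <= Ly * (b - e) ^+ 2 by rewrite mulr_ge0 ?sqr_ge0.
by lra.
Qed.

(** * Estimates along the iterates of the algorithm *)

Section Convergence.
Context (R : realType) (H G : hilbertType R).
Context (Phi : H -> G -> \bar R) (g : G -> \bar R) (gradPhi : H -> G -> G).
Context (nu Lyx Lyy : R).
Context (Phi_codom : forall x y, Phi x y != -oo%E).
Context (g_proper : eproper g) (g_convex : convex_modulus nu g).
Context (nu_gt0 : 0 < nu).
Context (Phi_x : forall y, edom g y ->
  eproper (Phi ^~ y) /\ econvex (Phi ^~ y)).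
Context (Phi_y_dom : forall x, proj_dom Phi x -> edom (Phi x) = setT).
Context (Phi_y_concave : forall x, proj_dom Phi x -> concave (fine \o Phi x)).
Context (Phi_y_grad : forall x y, proj_dom Phi x ->
  is_gradient (fine \o Phi x) y (gradPhi x y)).
Context (Lyx_ge0 : 0 <= Lyx) (Lyy_ge0 : 0 <= Lyy).
Context (grad_lip : forall x y x' y',
  proj_dom Phi x -> edom g y -> proj_dom Phi x' -> edom g y' ->
  `|gradPhi x y - gradPhi x' y'| <= Lyx * `|x - x'| + Lyy * `|y - y'|).
Context (calpha : R) (tau sigma theta : nat -> R).
Context (calpha_gt : Lyx < calpha) (theta0 : theta 0%N = 1).
Context (tau0_gt0 : 0 < tau 0%N) (sigma0_gt0 : 0 < sigma 0%N).
Context (thetaS : forall k, theta k.+1 = 1 / Num.sqrt (1 + nu * sigma k)).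
Context (tauS : forall k, tau k.+1 = tau k / theta k.+1).
Context (sigmaS : forall k, sigma k.+1 = theta k.+1 * sigma k).
Context (xs : H) (ys : G) (xs_ys_saddle : saddle_point Phi g xs ys).
Context (x : nat -> H) (y : nat -> G).
Context (x_y_iter : OGAProx Phi g gradPhi sigma tau theta x y).

Let sigma_pos := sigma_gt0 nu_gt0 sigma0_gt0 thetaS sigmaS.
Let tau_pos := tau_gt0 nu_gt0 tau0_gt0 sigma0_gt0 thetaS tauS sigmaS.
Let tau_pred k : tau k.-1 <= tau k.
Proof. exact: (tau_pred_le nu_gt0 tau0_gt0 sigma0_gt0 thetaS tauS sigmaS). Qed.
Let tausigma := tau_sigma nu_gt0 sigma0_gt0 thetaS tauS sigmaS.
Let sigmale := sigma_le0 nu_gt0 sigma0_gt0 thetaS sigmaS.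

Let t k := tau k / tau 0%N.
Let grad k := gradPhi (x k) (y k).
Let d k := grad k - grad k.-1.
Let gap u v :=
  fine (Phi u ys) - fine (g ys) - (fine (Phi xs v) - fine (g v)).

Let t_gt0 k : 0 < t k. Proof. by rewrite divr_gt0. Qed.

(** The dual iterate comes first: once [y k.+1] lies in [edom g], the function [Phi ^~ (y k.+1)] is
    proper, so its proximal point also has a finite value. *)
Lemma iter_dom k : proj_dom Phi (x k) /\ edom g (y k).
Proof.
have [Px0 gy0 step] := x_y_iter; case: k => [//|k].
have [v gv] := g_proper.2.
have [py px] := step k.
have gy : edom g (y k.+1).
  have := prox_fin g_proper.1 (sigma_pos k) py gv.
  by rewrite /edom /= fin_numE ltey => /andP[].
split=> //; have [[_ [u Pu]] _] := Phi_x gy; exists (y k.+1).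
have := prox_fin (fun v => Phi_codom v _) (tau_pos k) px Pu.
by rewrite fin_numE ltey => /andP[].
Qed.

Lemma xs_dom : proj_dom Phi xs.
Proof.
have [Px0 _ _] := x_y_iter.
by apply: saddle_proj_dom xs_ys_saddle _ => //; exists (x 0%N).
Qed.

Lemma ys_dom : edom g ys.
Proof.
have [Px0 _ _] := x_y_iter.
by apply: saddle_edom xs_ys_saddle _ => //; exists (x 0%N).
Qed.

(** Sum of three inequalities: the proximal step for [g] tested at [ys], the one for [Phi] tested at
    [xs], and concavity at [y k.+1]. The dual step uses the direction [grad k + theta k *: d k];
    subtracted from [grad k.+1] it leaves [d k.+1 - theta k *: d k]. *)
Lemma gap_step k : gap (x k.+1) (y k.+1) <=
  inner (d k.+1) (ys - y k.+1) - theta k * inner (d k) (ys - y k.+1)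
  + (tau k)^-1 * (2^-1 * (`|xs - x k| ^+ 2 - `|x k.+1 - x k| ^+ 2
                          - `|xs - x k.+1| ^+ 2))
  + (sigma k)^-1 * (2^-1 * (`|ys - y k| ^+ 2 - `|y k.+1 - y k| ^+ 2
                            - `|ys - y k.+1| ^+ 2))
  - nu / 2 * `|ys - y k.+1| ^+ 2.
Proof.
have [_ _ step] := x_y_iter; have [py px] := step k.
have [Px gy] := iter_dom k.+1.
have [_ Phi_cvx] := Phi_x gy.
have := prox_ineq g_convex g_proper.1 (sigma_pos k) py
  (esym (fineK (edom_fin g_proper ys_dom))).
have := prox_ineq (econvex_modulus0 Phi_cvx) (fun v => Phi_codom v _)
  (tau_pos k) px (esym (fineK (proj_dom_fin Phi_codom Phi_y_dom (y k.+1) xs_dom))).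
have := concave_gradient ys (Phi_y_concave Px) (Phi_y_grad (y k.+1) Px).
rewrite -/(grad k.+1) -/(grad k) -/(grad k.-1) /=.
rewrite (distrC (x k.+1)) (distrC (y k.+1)) -!inner_polar.
set w := ys - y k.+1; set q := sigma k *: _.
have -> : inner (y k + q - y k.+1) w = inner (y k - y k.+1) w + inner q w.
  by rewrite -innerDl addrAC.
rewrite /q /d /= !(innerZl, innerDl, innerNl) /gap mul0r mul0r.
have s0 : sigma k != 0 by rewrite gt_eqF.
by rewrite !mulrDr !(mulKf s0); lra.
Qed.

(** * Absorbing the gradient coupling, and the telescoping inequality *)

Let kappa := (calpha * Lyx * tau 0%N + 2 * Lyy) * sigma 0%N.

Let calpha_gt0 : 0 < calpha. Proof. exact: le_lt_trans calpha_gt. Qed.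

Let t_pred_le k : t k.-1 <= t k.
Proof.
by rewrite ler_pM2r ?invr_gt0.
Qed.

Lemma coupling_bound k u : `|inner (d k) u| <=
  Lyx / calpha * (`|x k - x k.-1| ^+ 2 / (2 * tau k.-1))
  + Lyy * (`|y k - y k.-1| ^+ 2 / 2)
  + (calpha * Lyx * tau k.-1 + Lyy) * (`|u| ^+ 2 / 2).
Proof.
apply: (le_trans (inner_CauchySchwarz (d k) u)); apply: young => //.
by have [? ?] := iter_dom k; have [? ?] := iter_dom k.-1; exact: grad_lip.
Qed.

(** The left side is the total coefficient of [|y k.+1 - y k|^2 / 2]: one part from
    [coupling_bound], and [t k * Lyy] stored in the next Lyapunov value. Constancy of
    [tau k * sigma k] and [sigma k <= sigma 0] reduce it to [kappa]. *)
Lemma coupling_weight k :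
  t k.-1 * (calpha * Lyx * tau k.-1 + Lyy) + t k * Lyy <=
  kappa * (t k / sigma k).
Proof.
have cL : 0 <= calpha * Lyx by rewrite mulr_ge0 // ltW.
apply: (@le_trans _ _ (t k * (calpha * Lyx * tau k + 2 * Lyy))).
  have -> : t k * (calpha * Lyx * tau k + 2 * Lyy) =
    t k * (calpha * Lyx * tau k + Lyy) + t k * Lyy by ring.
  rewrite lerD2r; apply: ler_pM => //; first exact: ltW.
    by rewrite addr_ge0 // mulr_ge0 // ltW.
  by rewrite lerD2r ler_wpM2l.
rewrite mulrCA ler_wpM2l ?(ltW (t_gt0 k)) // ler_pdivlMr //.
rewrite [kappa]mulrDl [leLHS]mulrDl lerD //.
  by rewrite -!mulrA tausigma.
by rewrite ler_wpM2l // mulr_ge0.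
Qed.

(* At k = 0 the terms involving the index k.-1 = k vanish. *)
Let lyapunov k :=
  `|xs - x k| ^+ 2 / (2 * tau 0%N) + t k / sigma k * (`|ys - y k| ^+ 2 / 2)
  - t k.-1 * inner (d k) (ys - y k)
  + t k.-1 * (Lyx / calpha * (`|x k - x k.-1| ^+ 2 / (2 * tau k.-1))
              + Lyy * (`|y k - y k.-1| ^+ 2 / 2)).

(** [gap_step] times [t k]. The negative squares of the two increments pay for the coupling:
    [kappa <= 1] suffices in the dual variable, [Lyx < calpha] in the primal one. *)
Lemma lyapunov_step k : kappa <= 1 ->
  t k * gap (x k.+1) (y k.+1) + lyapunov k.+1 <= lyapunov k.
Proof.
move=> kappa1; have tk := t_gt0 k.
have tS : t k.+1 / sigma k.+1 = t k * ((sigma k)^-1 + nu).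
  exact: (weight_sigmaS nu_gt0 tau0_gt0 sigma0_gt0 thetaS tauS sigmaS).
have tth : t k * theta k = t k.-1.
  exact: (weight_theta nu_gt0 theta0 tau0_gt0 sigma0_gt0 thetaS tauS sigmaS).
have ttau : t k * (tau k)^-1 = (tau 0%N)^-1.
  by rewrite /t mulrAC divff ?gt_eqF // mul1r.
have hcpl : - (t k.-1 * inner (d k) (y k - y k.+1)) <= t k.-1 *
    (Lyx / calpha * (`|x k - x k.-1| ^+ 2 / (2 * tau k.-1)) +
     Lyy * (`|y k - y k.-1| ^+ 2 / 2) +
     (calpha * Lyx * tau k.-1 + Lyy) * (`|y k.+1 - y k| ^+ 2 / 2)).
  rewrite -mulrN ler_wpM2l ?(ltW (t_gt0 _)) // (distrC (y k.+1)).
  by apply: le_trans (coupling_bound k _); rewrite -normrN ler_norm.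
have hw := ler_wpM2r (sqr_ge0 `|y k.+1 - y k|) (coupling_weight k).
have heta : kappa * (t k / sigma k) * `|y k.+1 - y k| ^+ 2 <=
    t k * (sigma k)^-1 * `|y k.+1 - y k| ^+ 2.
  by rewrite -mulrA ler_piMl // mulr_ge0 ?sqr_ge0 // ltW // divr_gt0.
have hxi : t k * (Lyx / calpha * (`|x k.+1 - x k| ^+ 2 / (2 * tau k))) <=
    (tau 0%N)^-1 * (`|x k.+1 - x k| ^+ 2 / 2).
  have -> : t k * (Lyx / calpha * (`|x k.+1 - x k| ^+ 2 / (2 * tau k))) =
      Lyx / calpha * ((tau 0%N)^-1 * (`|x k.+1 - x k| ^+ 2 / 2)).
    by rewrite -ttau invfM; ring.
  rewrite ler_piMl //; last by rewrite ler_pdivrMr // mul1r ltW.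
  by rewrite mulr_ge0 ?invr_ge0 ?divr_ge0 ?sqr_ge0 ?(ltW tau0_gt0).
have := ler_wpM2l (ltW tk) (gap_step k).
(* The first part already sits in [lyapunov k]; the second is controlled by [hcpl]. *)
have -> : inner (d k) (ys - y k.+1) =
    inner (d k) (ys - y k) + inner (d k) (y k - y k.+1).
  by rewrite -innerDr addrA subrK.
rewrite /lyapunov /= tS invfM.
rewrite !(mulrDr (t k)) !(mulrN (t k)).
rewrite (mulrA (t k) (theta k)) tth (mulrA (t k) (tau k)^-1) ttau.
by lra.
Qed.

Lemma gap_sum K : kappa <= 1 ->
  \sum_(0 <= k < K) t k * gap (x k.+1) (y k.+1) + lyapunov K <= lyapunov 0%N.
Proof.
move=> kappa1; elim: K => [|K IH]; first by rewrite big_geq // add0r.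
rewrite big_nat_recr //= -addrA; apply: le_trans IH.
by rewrite lerD2l lyapunov_step.
Qed.

Lemma lyapunov0 : lyapunov 0%N =
  1 / (2 * tau 0%N) * `|xs - x 0%N| ^+ 2 + 1 / (2 * sigma 0%N) * `|ys - y 0%N| ^+ 2.
Proof.
rewrite /lyapunov /= /d /= !subrr !normr0 -(scale0r (0 : G)) innerZl /t.
by field; rewrite !gt_eqF.
Qed.

(** [coupling_bound] at [ys - y K] uses up the stored squares and at most the fraction [kappa] of
    the dual distance. A free [delta] also covers [delta = 0], which is plain nonnegativity. *)
Lemma lyapunov_ge K delta : delta <= 1 - kappa ->
  delta * (t K / sigma K * (`|ys - y K| ^+ 2 / 2)) <= lyapunov K.
Proof.
move=> dk; rewrite /lyapunov.
have hcpl : t K.-1 * inner (d K) (ys - y K) <= t K.-1 *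
    (Lyx / calpha * (`|x K - x K.-1| ^+ 2 / (2 * tau K.-1)) +
     Lyy * (`|y K - y K.-1| ^+ 2 / 2) +
     (calpha * Lyx * tau K.-1 + Lyy) * (`|ys - y K| ^+ 2 / 2)).
  rewrite ler_wpM2l ?(ltW (t_gt0 _)) //.
  by apply: le_trans (coupling_bound K _); rewrite ler_norm.
have hw := ler_wpM2r (sqr_ge0 `|ys - y K|) (coupling_weight K).
have hx : 0 <= `|xs - x K| ^+ 2 / (2 * tau 0%N).
  by rewrite divr_ge0 ?sqr_ge0 // mulr_ge0 // ltW.
have hL := mulr_ge0 (mulr_ge0 (ltW (t_gt0 K)) Lyy_ge0) (sqr_ge0 `|ys - y K|).
have hd : delta * (t K / sigma K * (`|ys - y K| ^+ 2 / 2)) <=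
    (1 - kappa) * (t K / sigma K * (`|ys - y K| ^+ 2 / 2)).
  by rewrite ler_wpM2r // mulr_ge0 // ltW // divr_gt0.
by lra.
Qed.

Lemma weighted_gap_le K : kappa <= 1 ->
  \sum_(0 <= k < K) t k * gap (x k.+1) (y k.+1) <=
  1 / (2 * tau 0%N) * `|xs - x 0%N| ^+ 2 + 1 / (2 * sigma 0%N) * `|ys - y 0%N| ^+ 2.
Proof.
move=> kappa1; rewrite -lyapunov0; apply: le_trans (gap_sum K kappa1).
rewrite lerDl; apply: le_trans (@lyapunov_ge K 0 _); first by rewrite mul0r.
by rewrite subr_ge0.
Qed.

(** The gaps are nonnegative, so [lyapunov K] alone is at most its initial value; its dual weight
    [t K / sigma K] equals [sigma 0 / sigma K ^ 2]. *)
Lemma dist_dual_le K delta : kappa <= 1 -> 0 < delta <= 1 - kappa ->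
  `|ys - y K| ^+ 2 <= 2 * sigma K ^+ 2 / (sigma 0%N * delta) *
  (1 / (2 * tau 0%N) * `|xs - x 0%N| ^+ 2 + 1 / (2 * sigma 0%N) * `|ys - y 0%N| ^+ 2).
Proof.
move=> kappa1 /andP[d0 dk].
have gap_pos : 0 <= \sum_(0 <= k < K) t k * gap (x k.+1) (y k.+1).
  apply: sumr_ge0 => k _; rewrite mulr_ge0 ?(ltW (t_gt0 k)) //.
  by have [? ?] := iter_dom k.+1; apply: gap_ge0.
have h := gap_sum K kappa1; have hK := @lyapunov_ge K delta dk.
have {}h : delta * (t K / sigma K * (`|ys - y K| ^+ 2 / 2)) <= lyapunov 0%N.
  by lra.
have tK : t K = sigma 0%N / sigma K.
  exact: (weightE nu_gt0 tau0_gt0 sigma0_gt0 thetaS tauS sigmaS).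
rewrite -lyapunov0 mulrAC ler_pdivlMr ?mulr_gt0 // mulrAC.
have s2 : 0 < 2 * sigma K ^+ 2 by rewrite mulr_gt0 // exprn_gt0.
move: h; rewrite -(ler_pM2l s2) tK; apply: le_trans.
rewrite le_eqVlt; apply/orP; left; apply/eqP; field.
by rewrite gt_eqF.
Qed.

Lemma mean_dom K : (0 < K)%N ->
  proj_dom Phi (weighted_mean t x K) /\ edom g (weighted_mean t y K).
Proof.
move=> K0; split.
  (* At the single point [ys] all iterates have finite [Phi], and the domain of [Phi ^~ ys] is
     convex. *)
  exists ys; have [_ cPhi] := Phi_x ys_dom.
  apply: le_lt_trans (ltry _); apply: (econvex_mean cPhi t_gt0 K0) => k.
  rewrite -[leLHS]fineK; first exact: lexx.
  by have [? _] := iter_dom k.+1; apply: proj_dom_fin.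
have cg := convex_modulusW (ltW nu_gt0) g_convex g_proper.1.
apply: le_lt_trans (ltry _); apply: (econvex_mean cg t_gt0 K0) => k.
rewrite -[leLHS]fineK; first exact: lexx.
by have [_ ?] := iter_dom k.+1; apply: edom_fin.
Qed.

(** Jensen's inequality for [Phi ^~ ys], for [g] and for the negative of [Phi xs]; the constant
    [g ys] is its own mean. *)
Lemma gap_mean K : (0 < K)%N ->
  gap (weighted_mean t x K) (weighted_mean t y K) <=
  (weight_sum t K)^-1 * \sum_(0 <= k < K) t k * gap (x k.+1) (y k.+1).
Proof.
move=> K0; have [Pxb gyb] := mean_dom K0.
have h1 : fine (Phi (weighted_mean t x K) ys) <=
    (weight_sum t K)^-1 * \sum_(0 <= k < K) t k * fine (Phi (x k.+1) ys).
  have [_ cPhi] := Phi_x ys_dom.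
  rewrite -lee_fin fineK; last exact: proj_dom_fin.
  apply: (econvex_mean cPhi t_gt0 K0) => k.
  by have [? _] := iter_dom k.+1; rewrite fineK //; apply: proj_dom_fin.
have h2 : fine (g (weighted_mean t y K)) <=
    (weight_sum t K)^-1 * \sum_(0 <= k < K) t k * fine (g (y k.+1)).
  have cg := convex_modulusW (ltW nu_gt0) g_convex g_proper.1.
  rewrite -lee_fin fineK; last exact: edom_fin.
  apply: (econvex_mean cg t_gt0 K0) => k.
  by have [_ ?] := iter_dom k.+1; rewrite fineK //; apply: edom_fin.
have h3 : - fine (Phi xs (weighted_mean t y K)) <=
    (weight_sum t K)^-1 * \sum_(0 <= k < K) t k * - fine (Phi xs (y k.+1)).
  have cPhi : econvex (fun v => (- fine (Phi xs v))%:E).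
    move=> s u v s01; rewrite -!EFinM -EFinD lee_fin.
    by have /= := concave_ge u v (Phi_y_concave xs_dom) s01; lra.
  by rewrite -lee_fin; apply: (econvex_mean cPhi t_gt0 K0) => k.
have W0 := weight_sum_gt0 t_gt0 K0.
have h4 : fine (g ys) =
    (weight_sum t K)^-1 * \sum_(0 <= k < K) t k * fine (g ys).
  by rewrite -mulr_suml mulrA mulVf ?mul1r // gt_eqF.
have -> : \sum_(0 <= k < K) t k * gap (x k.+1) (y k.+1) =
    \sum_(0 <= k < K) t k * fine (Phi (x k.+1) ys)
    - \sum_(0 <= k < K) t k * fine (g ys)
    + \sum_(0 <= k < K) t k * - fine (Phi xs (y k.+1))
    + \sum_(0 <= k < K) t k * fine (g (y k.+1)).
  rewrite -sumrB -!big_split; apply: eq_bigr => k _ /=.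
  by rewrite /gap; ring.
by rewrite /gap !mulrDr mulrN -h4; lra.
Qed.

End Convergence.

(** * The two rates with explicit constants *)

Theorem theorem11 (R : realType) (H G : hilbertType R)
  (Phi : H -> G -> \bar R) (g : G -> \bar R) (gradPhi : H -> G -> G)
  (nu Lyx Lyy : R)
  (Phi_codom : forall x y, Phi x y != -oo%E)
  (Phi_dom : exists x y, (Phi x y < +oo)%E)
  (* (i) *)
  (g_proper : eproper g)
  (g_lsc : lower_semicontinuous g)
  (g_convex : convex_modulus nu g)
  (nu_gt0 : 0 < nu)
  (* (ii) *)
  (Phi_x : forall y, edom g y ->
     [/\ eproper (Phi ^~ y), econvex (Phi ^~ y) &
         lower_semicontinuous (Phi ^~ y)])
  (* (iii) *)
  (Phi_y_dom : forall x, proj_dom Phi x -> edom (Phi x) = setT)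
  (Phi_y_concave : forall x, proj_dom Phi x -> concave (fine \o Phi x))
  (Phi_y_grad : forall x y, proj_dom Phi x ->
     is_gradient (fine \o Phi x) y (gradPhi x y))
  (proj_closed : closed (proj_dom Phi))
  (* (iv) *)
  (Lyx_ge0 : 0 <= Lyx) (Lyy_ge0 : 0 <= Lyy)
  (grad_lip : forall x y x' y',
     proj_dom Phi x -> edom g y -> proj_dom Phi x' -> edom g y' ->
     `|gradPhi x y - gradPhi x' y'| <= Lyx * `|x - x'| + Lyy * `|y - y'|)
  (* parameters *)
  (calpha : R) (tau sigma theta : nat -> R)
  (calpha_gt : Lyx < calpha)
  (theta0 : theta 0%N = 1)
  (tau0_gt0 : 0 < tau 0%N) (sigma0_gt0 : 0 < sigma 0%N)
  (sigma0_lt : (calpha * Lyx * tau 0%N + 2 * Lyy) * sigma 0%N < 1)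
  (sigma0_le : sigma 0%N <= (9 + 3 * Num.sqrt 13) / (2 * nu))
  (thetaS : forall k, theta k.+1 = 1 / Num.sqrt (1 + nu * sigma k))
  (tauS : forall k, tau k.+1 = tau k / theta k.+1)
  (sigmaS : forall k, sigma k.+1 = theta k.+1 * sigma k)
  (* saddle point and iterates *)
  (xs : H) (ys : G) (xs_ys_saddle : saddle_point Phi g xs ys)
  (x : nat -> H) (y : nat -> G)
  (x_y_iter : OGAProx Phi g gradPhi sigma tau theta x y) :
  let delta := Num.min (1 - Lyx / calpha)
                 (1 - (calpha * Lyx * tau 0%N + 2 * Lyy) * sigma 0%N) in
  let c1 := Num.sqrt (18 / (nu ^+ 2 * sigma 0%N * delta)) in
  let c2 := 12 / (nu * sigma 0%N) in
  let D0 := 1 / (2 * tau 0%N) * `|xs - x 0%N| ^+ 2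
            + 1 / (2 * sigma 0%N) * `|ys - y 0%N| ^+ 2 in
  let t := fun k => tau k / tau 0%N in
  let xbar := weighted_mean t x in
  let ybar := weighted_mean t y in
  [/\ forall k, [/\ theta k.+1 < 1, tau k < tau k.+1 & sigma k.+1 < sigma k],
      0 < delta,
      forall K : nat, (1 <= K)%N ->
        `|ys - y K| <= c1 / K%:R * Num.sqrt D0 &
      forall K : nat, (2 <= K)%N ->
        (0 <= Psi Phi g (xbar K) ys - Psi Phi g xs (ybar K) /\
         Psi Phi g (xbar K) ys - Psi Phi g xs (ybar K)
           <= (c2 / K%:R ^+ 2 * D0)%:E)%E].
Proof.
have Phi_x' v : edom g v -> eproper (Phi ^~ v) /\ econvex (Phi ^~ v).
  by move=> /Phi_x[].
have calpha_gt0 : 0 < calpha := le_lt_trans Lyx_ge0 calpha_gt.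
move=> delta c1 c2 D0 t xbar ybar.
set kappa := (calpha * Lyx * tau 0%N + 2 * Lyy) * sigma 0%N in sigma0_lt.
have kappa1 : kappa <= 1 by rewrite ltW.
have delta_gt0 : 0 < delta.
  by rewrite /delta lt_min !subr_gt0 ltr_pdivrMr // mul1r calpha_gt.
have delta_le : 0 < delta <= 1 - kappa by rewrite delta_gt0 /delta ge_min lexx orbT.
have D0_ge0 : 0 <= D0.
  by rewrite addr_ge0 // mulr_ge0 ?sqr_ge0 // divr_ge0 // mulr_ge0 // ltW.
split=> //.
- move=> k; split.
  + exact: thetaS_lt1 sigma0_gt0 thetaS sigmaS k.
  + exact: tauS_gt tau0_gt0 sigma0_gt0 thetaS tauS sigmaS k.
  + exact: sigmaS_lt sigma0_gt0 thetaS sigmaS k.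
(* [K >= 1] becomes a successor because [sigmaS_le] bounds [sigma] at successor indices only. *)
- case=> // K _.
  have K0 : 0 < K.+1%:R :> R by rewrite ltr0n.
  have sK := sigma_gt0 nu_gt0 sigma0_gt0 thetaS sigmaS K.+1.
  have sle := sigmaS_le nu_gt0 sigma0_gt0 thetaS sigmaS K sigma0_le.
  have c1_sqr : c1 ^+ 2 = 18 / (nu ^+ 2 * sigma 0%N * delta).
    by rewrite sqr_sqrtr // divr_ge0 // !mulr_ge0 ?sqr_ge0 // ltW.
  have c1_ge0 : 0 <= c1 by rewrite sqrtr_ge0.
  rewrite -ler_sqr ?nnegrE ?mulr_ge0 ?sqrtr_ge0 ?divr_ge0 ?(ltW K0) //.
  rewrite exprMn sqr_sqrtr //.
  apply: le_trans (dist_dual_le Phi_codom g_proper g_convex nu_gt0 Phi_x'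
    Phi_y_dom Phi_y_concave Phi_y_grad Lyx_ge0 Lyy_ge0 grad_lip calpha_gt
    theta0 tau0_gt0 sigma0_gt0 thetaS tauS sigmaS xs_ys_saddle x_y_iter K.+1
    kappa1 delta_le) _.
  rewrite -/D0 ler_wpM2r // expr_div_n c1_sqr.
  (* The 18 in [c1] is the factor 2 of [dist_dual_le] times this [3 ^ 2]. *)
  have h : (nu * sigma K.+1) ^+ 2 <= (3 / K.+1%:R) ^+ 2.
    by rewrite ler_sqr ?nnegrE // ?divr_ge0 ?(ltW K0) // mulr_ge0 // ltW.
  have c0 : 0 < nu ^+ 2 * (sigma 0%N * delta) by rewrite !mulr_gt0 ?exprn_gt0.
  rewrite -(ler_pM2l c0).
  have -> : nu ^+ 2 * (sigma 0%N * delta) *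
      (2 * sigma K.+1 ^+ 2 / (sigma 0%N * delta)) = 2 * (nu * sigma K.+1) ^+ 2.
    by field; rewrite !gt_eqF.
  have -> : nu ^+ 2 * (sigma 0%N * delta) * (18 / (nu ^+ 2 * sigma 0%N * delta)
      / K.+1%:R ^+ 2) = 2 * (3 / K.+1%:R) ^+ 2.
    by field; rewrite !gt_eqF.
  by rewrite ler_pM2l.
- move=> K K2; have K0 : (0 < K)%N by exact: ltnW.
  have [Pxb gyb] := mean_dom Phi_codom g_proper g_convex nu_gt0 Phi_x'
    Phi_y_dom tau0_gt0 sigma0_gt0 thetaS tauS sigmaS xs_ys_saddle x_y_iter K0.
  have gapm := gap_mean Phi_codom g_proper g_convex nu_gt0 Phi_x'
    Phi_y_dom Phi_y_concave tau0_gt0 sigma0_gt0 thetaS tauS sigmaS xs_ys_saddle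
    x_y_iter K0.
  have gap0 := gap_ge0 Phi_codom g_proper Phi_y_dom xs_ys_saddle Pxb gyb.
  have Pxs := xs_dom Phi_codom g_proper Phi_y_dom xs_ys_saddle x_y_iter.
  have gys := ys_dom Phi_codom g_proper Phi_y_dom xs_ys_saddle x_y_iter.
  have sumD := weighted_gap_le Phi_codom g_proper g_convex nu_gt0 Phi_x'
    Phi_y_dom Phi_y_concave Phi_y_grad Lyx_ge0 Lyy_ge0 grad_lip calpha_gt
    theta0 tau0_gt0 sigma0_gt0 thetaS tauS sigmaS xs_ys_saddle x_y_iter K
    kappa1.
  have W := weight_sum_ge nu_gt0 tau0_gt0 sigma0_gt0 thetaS tauS sigmaS
    sigma0_le K2.
  rewrite (Psi_fin Phi_codom g_proper Phi_y_dom Pxb gys).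
  rewrite (Psi_fin Phi_codom g_proper Phi_y_dom Pxs gyb).
  rewrite -EFinB !lee_fin; split=> //.
  apply: le_trans gapm _.
  have KR : 0 < K%:R :> R by rewrite ltr0n.
  have m0 : 0 < K%:R ^+ 2 * (nu * sigma 0%N / 12).
    by rewrite mulr_gt0 ?exprn_gt0 // divr_gt0 // mulr_gt0.
  (* [c2 / K^2] is the reciprocal of the lower bound [W] for the sum of the weights. *)
  have -> : c2 / K%:R ^+ 2 * D0 = (K%:R ^+ 2 * (nu * sigma 0%N / 12))^-1 * D0.
    by rewrite /c2; field; rewrite !gt_eqF.
  have W0 := lt_le_trans m0 W.
  apply: (le_trans (ler_wpM2l _ sumD)); first by rewrite invr_ge0 ltW.
  by rewrite ler_wpM2r // lef_pV2.
Qed.
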